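(* For every $M\in\mathcal{PG}$ we have $M\in\mathcal{GPG}$ and $\operatorname{ord}(M)=\operatorname{ord}^*(M)$.
   Context: $\mathbb{R}_+:=(0,\infty)$. A (bivariate) mean is an arbitrary function $M\colon\mathbb{R}_+\times\mathbb{R}_+\to\mathbb{R}_+$ with $\min(x,y)\le M(x,y)\le\max(x,y)$ for all $x,y\in\mathbb{R}_+$. It is symmetric if $M(x,y)=M(y,x)$ for all $x,y\in\mathbb{R}_+$, and homogeneous if $M(tx,ty)=tM(x,y)$ for all $x,y,t\in\mathbb{R}_+$. $\mathcal{HS}$ denotes the family of all homogeneous, symmetric means $M\colon\mathbb{R}_+^2\to\mathbb{R}_+$. A mean $M\in\mathcal{HS}$ is of power growth if there exist a real number $\operatorname{ord}(M)$ (called the order of $M$) and a number $C_M\in(0,\infty)$ such that $\lim_{x\to0^+}\frac{M(x,1)}{x^{\operatorname{ord}(M)}}=C_M$; $\mathcal{PG}$ denotes the class of all $M\in\mathcal{HS}$ of power growth. For $M\in\mathcal{HS}$ the lower order and upper order are the real numbers $$\operatorname{lord}(M):=\sup\Big\{\alpha\in\mathbb{R}\colon \limsup_{x\to0^+}\frac{M(x,1)}{x^\alpha}=0\Big\},\qquad \operatorname{uord}(M):=\inf\Big\{\alpha\in\mathbb{R}\colon \liminf_{x\to0^+}\frac{M(x,1)}{x^\alpha}=\infty\Big\}.$$ A mean $M\in\mathcal{HS}$ is of generalized power growth if $\operatorname{lord}(M)=\operatorname{uord}(M)$; $\mathcal{GPG}$ denotes the class of all such means, and for $M\in\mathcal{GPG}$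 one sets $\operatorname{ord}^*(M):=\operatorname{lord}(M)=\operatorname{uord}(M)$. *)

(* Defs.v *)
From mathcomp Require Import all_boot all_order all_algebra.
From mathcomp Require Import all_classical all_reals all_analysis.

Set Implicit Arguments.
Unset Strict Implicit.
Unset Printing Implicit Defensive.

Import Order.TTheory GRing.Theory Num.Theory.
Import numFieldNormedType.Exports.

Local Open Scope classical_set_scope.
Local Open Scope ring_scope.

(* Means are functions on (0, oo)^2, represented by M : R -> R -> R whose
   values at nonpositive arguments are never used; on (0, oo)^2 the lower
   bound min(x, y) <= M x y forces M x y > 0. *)
Definition is_mean (R : realType) (M : R -> R -> R) : Prop :=
  forall x y : R, 0 < x -> 0 < y -> Num.min x y <= M x y <= Num.max x y.

Definition symmetric_mean (R : realType) (M : R -> R -> R) : Prop :=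
  forall x y : R, 0 < x -> 0 < y -> M x y = M y x.

Definition homogeneous_mean (R : realType) (M : R -> R -> R) : Prop :=
  forall x y t : R, 0 < x -> 0 < y -> 0 < t -> M (t * x) (t * y) = t * M x y.

Definition HS (R : realType) : set (R -> R -> R) :=
  [set M | [/\ is_mean M, symmetric_mean M & homogeneous_mean M]].

Definition growth_ratio (R : realType) (M : R -> R -> R) (alpha x : R) : R :=
  M x 1 / x `^ alpha.

Definition has_order (R : realType) (M : R -> R -> R) (alpha : R) : Prop :=
  exists2 C : R, 0 < C & growth_ratio M alpha x @[x --> 0^'+] --> C.

Definition PG (R : realType) : set (R -> R -> R) :=
  [set M | HS M /\ exists alpha : R, has_order M alpha].

(* An alpha with has_order M alpha is unique when it exists; otherwise the
   value is 0. *)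
Definition ord (R : realType) (M : R -> R -> R) : R :=
  xget 0 [set alpha | has_order M alpha].

(* For M in HS, x <= M x 1 <= 1 on (0, 1], so the set below contains every
   alpha < 0 and is bounded above by 1; hence the real-valued sup is the true
   supremum. Dually for uord: the set contains every alpha > 1 and is bounded
   below by 0. *)
Definition lord (R : realType) (M : R -> R -> R) : R :=
  sup [set alpha : R |
    limf_esup (fun x => (growth_ratio M alpha x)%:E) 0^'+ = 0%E].

Definition uord (R : realType) (M : R -> R -> R) : R :=
  inf [set alpha : R |
    limf_einf (fun x => (growth_ratio M alpha x)%:E) 0^'+ = +oo%E].

Definition GPG (R : realType) : set (R -> R -> R) :=
  [set M | HS M /\ lord M = uord M].

(* Meaningful for M in GPG, where it also equals uord M. *)
Definition ord_star (R : realType) (M : R -> R -> R) : R := lord M.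

(* Main.v *)
(* If M(x,1) / x^a tends to some C > 0 as x -> 0+, then
   M(x,1) / x^b = (M(x,1) / x^a) x^(a-b) tends to 0 for b < a and to +oo for
   b > a.  Hence the set defining lord M is ]-oo, a[ and the set defining
   uord M is ]a, +oo[. *)
Require Import Defs.
From mathcomp Require Import all_boot all_order all_algebra.
From mathcomp Require Import all_classical all_reals all_analysis.

Import Order.TTheory GRing.Theory Num.Theory.
Import numFieldNormedType.Exports.

Local Open Scope classical_set_scope.
Local Open Scope ring_scope.

(** For every [V] in [F], the supremum of [f] over [V] eventually bounds [f], hence bounds [l].
    Conversely, any eventual upper bound of [f] bounds the limit superior. *)
Lemma cvg_limf_esup (R : realType) (T : choiceType) (X : filteredType T)
    (F : set_system X) (FF : ProperFilter F) (f : X -> \bar R) (l : \bar R) :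
  f x @[x --> F] --> l -> limf_esup f F = l.
Proof.
move=> fl; apply/eqP; rewrite eq_le; apply/andP; split; last first.
  rewrite limf_esupE; apply: le_ereal_inf_tmp => _ [V FV <-].
  apply: cvge_to_le fl _; apply: filterS FV => x Vx.
  by apply: ereal_sup_ubound; exists x.
have esup_le b : F [set x | (f x <= b)%E] -> (limf_esup f F <= b)%E.
  move=> Fb; rewrite limf_esupE.
  apply: (@le_trans _ _ (ereal_sup (f @` [set x | (f x <= b)%E]))).
    by apply: ereal_inf_lbound; exists [set x | (f x <= b)%E].
  by apply: ge_ereal_sup => _ [x fxb <-].
have flt b : (l < b)%E -> F [set x | (f x < b)%E].
  by move=> lb; exact: (fl _ (open_ereal_lt' lb)).
rewrite leNgt; apply/negP => ls.
(* Either some c separates l from the limit superior, or f x <= l as soon as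
   f x is below the limit superior. *)
have [[c [lc cs]]|noc] := pselect (exists c, l < c /\ c < limf_esup f F)%E.
  have : (limf_esup f F <= c)%E.
    by apply: esup_le; apply: filterS (flt _ lc) => x /ltW.
  by rewrite leNgt cs.
have : (limf_esup f F <= l)%E.
  apply: esup_le; apply: filterS (flt _ ls) => x fxs.
  by rewrite /= leNgt; apply/negP => lfx; apply: noc; exists (f x).
by rewrite leNgt ls.
Qed.

Lemma cvg_limf_einf (R : realType) (T : choiceType) (X : filteredType T)
    (F : set_system X) (FF : ProperFilter F) (f : X -> \bar R) (l : \bar R) :
  f x @[x --> F] --> l -> limf_einf f F = l.
Proof. by move=> /cvgeN /cvg_limf_esup; rewrite limf_esupN => /oppe_inj. Qed.

Section order_of_growth.
Variables (R : realType) (M : R -> R -> R) (a : R).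
Hypothesis Ma : has_order M a.

Lemma growth_ratio_shift (b x : R) : 0 < x ->
  growth_ratio M b x = growth_ratio M a x * x `^ (a - b).
Proof.
move=> x0; rewrite /growth_ratio powRB; last by rewrite (gt_eqF x0) implybT.
by rewrite mulrA divfK// gt_eqF// powR_gt0.
Qed.

(** Positivity near 0 comes from the limit [C > 0] at exponent [a]; it allows passing to reciprocals
    in [growth_ratio_cvgy]. *)
Lemma growth_ratio_gt0 (b : R) : \forall x \near 0^'+, 0 < growth_ratio M b x.
Proof.
have [C C0 MC] := Ma; near=> x.
have x0 : 0 < x by near: x; exact: nbhs_right_gt.
rewrite growth_ratio_shift// mulr_gt0 ?powR_gt0//.
by near: x; exact: (cvgr_gt C).
Unshelve. all: by end_near. Qed.

Lemma growth_ratio_cvg0 (b : R) : b < a -> growth_ratio M b x @[x --> 0^'+] --> 0.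
Proof.
move=> ba; have [C C0 MC] := Ma.
have ab0 : 0 < a - b by rewrite subr_gt0.
have cvg0 : growth_ratio M a x * x `^ (a - b) @[x --> 0^'+] --> (0 : R).
  by rewrite -[X in _ --> X](mulr0 C); exact: cvgM MC (powR_cvg0 ab0).
apply: cvg_trans cvg0; apply: near_eq_cvg; near=> x.
have x0 : 0 < x by near: x; exact: nbhs_right_gt.
by rewrite /= -growth_ratio_shift.
Unshelve. all: by end_near. Qed.

Lemma growth_ratio_cvgy (b : R) : a < b ->
  growth_ratio M b x @[x --> 0^'+] --> +oo.
Proof.
move=> ab; have [C C0 MC] := Ma.
(* An eventually positive function tends to [+oo] when its reciprocal tends to 0; here the
   reciprocal has limit [C^-1 * 0]. *)
apply/gtr0_cvgV0; first exact: growth_ratio_gt0.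
have ba0 : 0 < b - a by rewrite subr_gt0.
have cvg0 : (growth_ratio M a x)^-1 * x `^ (b - a) @[x --> 0^'+] --> (0 : R).
  rewrite -[X in _ --> X](mulr0 C^-1).
  exact: cvgM (cvgV (lt0r_neq0 C0) MC) (powR_cvg0 ba0).
apply: cvg_trans cvg0; apply: near_eq_cvg; near=> x.
have x0 : 0 < x by near: x; exact: nbhs_right_gt.
by rewrite [RHS]/= [in RHS]growth_ratio_shift// [RHS]invfM -[in RHS]powRN opprB.
Unshelve. all: by end_near. Qed.

Lemma lord_has_order : lord M = a.
Proof.
(* The flag [true] makes the right endpoint open: [a] is written as the supremum of []-oo, a[]. *)
rewrite -[RHS](@sup_itv R -oo%O true a)//; congr sup; apply/seteqP.
split=> b /=; rewrite in_itv/=; last first.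
  move=> /growth_ratio_cvg0 M0; apply: cvg_limf_esup.
  by apply: cvg_EFin; [exact: nearW|exact: M0].
(* For [b > a] the limit superior is [+oo], and for [b = a] it is [C > 0]; neither is 0. *)
have [//|ab|->] := ltgtP b a.
  have /cvgeryP/cvg_limf_esup -> // := growth_ratio_cvgy _ ab.
have [C C0 MC] := Ma.
have /cvg_limf_esup -> : (growth_ratio M a x)%:E @[x --> 0^'+] --> C%:E.
  by apply: cvg_EFin; [exact: nearW|exact: MC].
by move=> [C0']; rewrite C0' ltxx in C0.
Qed.

Lemma uord_has_order : uord M = a.
Proof.
rewrite -[RHS](@inf_itv R +oo%O false a)//; congr inf; apply/seteqP.
split=> b /=; rewrite in_itv/= andbT; last first.
  by move=> /growth_ratio_cvgy My; apply: cvg_limf_einf; exact/cvgeryP.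
(* For [b < a] the limit inferior is 0, and for [b = a] it is [C]; both are finite. *)
have [//|ba|<-] := ltgtP a b.
  have /cvg_limf_einf -> // : (growth_ratio M b x)%:E @[x --> 0^'+] --> 0%:E.
  by apply: cvg_EFin; [exact: nearW|exact: growth_ratio_cvg0].
have [C C0 MC] := Ma.
have /cvg_limf_einf -> // : (growth_ratio M a x)%:E @[x --> 0^'+] --> C%:E.
by apply: cvg_EFin; [exact: nearW|exact: MC].
Qed.

End order_of_growth.

Theorem corollary3p2 (R : realType) (M : R -> R -> R) :
  PG M -> GPG M /\ ord M = ord_star M.
Proof.
(* Since some order exists, [ord M] is an actual order and not just the default 0, so both
   computations apply with [a := ord M]. *)
move=> [HSM exM]; have Mord : has_order M (ord M) := xgetPex 0 exM.
rewrite /ord_star; split; last by rewrite (lord_has_order _ _ _ Mord).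
by split=> //; rewrite (lord_has_order _ _ _ Mord) (uord_has_order _ _ _ Mord).
Qed.
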